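(* Let $k\ge1$ and let $(X,\mathbb{Z}^k,T)$ be a continuum-wise expansive $\mathbb{Z}^k$-action. Then there is a finite constant $C\ge0$, depending only on $(X,\mathbb{Z}^k,T)$, such that $\mathrm{mdim}(X,T,\langle\vec v\rangle^{\perp})\le C$ for every nonzero $\vec v\in\mathbb{R}^k$. In particular, all $(k-1)$-dimensional directional mean dimensions of $(X,\mathbb{Z}^k,T)$ are finite.
   Context: A $\mathbb{Z}^k$-action $(X,\mathbb{Z}^k,T)$ is a compact metric space $X$ together with a continuous map $T\colon\mathbb{Z}^k\times X\to X$, $(n,x)\mapsto T^nx$, with $T^0x=x$ and $T^{m+n}x=T^m(T^nx)$. $C(X)$ denotes the set of nonempty connected closed subsets of $X$, and a set is nondegenerate if it has at least two points. The action is continuum-wise expansive if there is $c>0$ such that for every nondegenerate $A\in C(X)$ there exists $n\in\mathbb{Z}^k$ with $\mathrm{diam}\,T^n(A)>c$. For a compact metric space $(X,d)$ and $\epsilon>0$, an $\epsilon$-embedding is a continuous $f\colon X\to Y$ such that $f(x)=f(x')$ implies $d(x,x')<\epsilon$. $\mathrm{Widim}_\epsilon(X,d)$ is the minimum of $\dim K$ over compact metric spaces $K$ admitting an $\epsilon$-embedding $X\to K$. Set $d^T_\Omega(x,x')=\max_{n\in\Omega}d(T^nx,T^nx')$ for finite $\Omega\subset\mathbb{Z}^k$. $[-N,N]^k$ is the integer cube; when intersected with a real subspace it means the real cube. Fix $r>\sqrt{k}/2$. For an $h$-dimensional subspace $V\subseteq\mathbb{R}^k$, let $B_r(V)=\{u\in\mathbb{Z}^k:|u-w|<r\text{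 for some }w\in V\}$, and define $$\mathrm{mdim}(X,T,V)=\lim_{\epsilon\to0}\ \liminf_{N\to\infty}\frac{\mathrm{Widim}_\epsilon\big(X,d^T_{B_r(V)\cap[-N,N]^k}\big)}{\mathrm{vol}_h\big(V\cap[-N,N]^k\big)},$$ where $d$ is a compatible metric and $\mathrm{vol}_0$ of the point $\{0\}$ is $1$; this value is independent of $r$ and $d$. $\langle\vec v\rangle^{\perp}$ is the $(k-1)$-dimensional subspace orthogonal to $\vec v$. *)

(* Defs.v *)
From HB Require Import structures.
From mathcomp Require Import all_boot all_order all_algebra.
From mathcomp Require Import all_classical all_reals all_analysis.
Set Implicit Arguments. Unset Strict Implicit. Unset Printing Implicit Defensive.
Import Order.TTheory GRing.Theory Num.Theory.
Import numFieldNormedType.Exports.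
Local Open Scope classical_set_scope.
Local Open Scope ring_scope.

(* Z^k-actions.  Z^k is 'rV[int]_k; Z^k is discrete, so continuity of       *)
(* (n,x) |-> T n x is continuity of each T n.                               *)
Definition is_Zk_action (k : nat) (X : topologicalType)
    (T : 'rV[int]_k -> X -> X) : Prop :=
  [/\ (forall x, T 0 x = x),
      (forall m n x, T (m + n) x = T m (T n x)) &
      (forall n, continuous (T n))].

Definition diam (R : realType) (X : metricType R) (A : set X) : \bar R :=
  ereal_sup [set (mdist p.1 p.2)%:E | p in A `*` A].

Definition cw_expansive (R : realType) (k : nat) (X : metricType R)
    (T : 'rV[int]_k -> X -> X) : Prop :=
  exists c : R, 0 < c /\
    forall A : set X, A !=set0 -> connected A -> closed A ->
      (exists x y, [/\ A x, A y & x <> y]) ->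
      exists n : 'rV[int]_k, (c%:E < diam (T n @` A))%E.

Definition covdim_le (K : topologicalType) (n : nat) : Prop :=
  forall (I : finType) (U : I -> set K),
    (forall i, open (U i)) -> [set: K] `<=` \bigcup_i U i ->
    exists (J : finType) (W : J -> set K),
      [/\ (forall j, open (W j)),
          [set: K] `<=` \bigcup_j W j,
          (forall j, exists i, W j `<=` U i) &
          (forall x : K, (#|[set j | `[< W j x >] ]| <= n.+1)%N)].

Definition eps_embedding (R : realType) (X : topologicalType) (K : Type)
    (dist : X -> X -> R) (eps : R) (f : X -> K) : Prop :=
  forall x x', f x = f x' -> dist x x' < eps.

Definition Widim (R : realType) (X : topologicalType)
    (dist : X -> X -> R) (eps : R) : \bar R :=
  ereal_inf [set (n%:R)%:E | n in
    [set n : nat | exists (K : metricType R) (f : X -> K),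
        [/\ compact [set: K], continuous f, eps_embedding dist eps f &
            covdim_le K n]]].

Definition dT (R : realType) (k : nat) (X : metricType R)
    (T : 'rV[int]_k -> X -> X) (Omega : set 'rV[int]_k) (x x' : X) : R :=
  sup [set mdist (T n x) (T n x') | n in Omega].

Definition intvec (R : realType) (k : nat) (u : 'rV[int]_k) : 'rV[R]_k :=
  \row_i ((u 0 i)%:~R).

Definition sqdist (R : realType) (k : nat) (u w : 'rV[R]_k) : R :=
  \sum_i (u 0 i - w 0 i) ^+ 2.

Definition Br (R : realType) (k : nat) (r : R) (V : set 'rV[R]_k)
    : set 'rV[int]_k :=
  [set u | exists2 w, V w & Num.sqrt (sqdist (intvec R u) w) < r].

Definition icube (k N : nat) : set 'rV[int]_k :=
  [set u | forall i, `|u 0 i| <= N%:Z].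
Definition rcube (R : realType) (k N : nat) : set 'rV[R]_k :=
  [set w | forall i, `|w 0 i| <= N%:R].

Definition box (R : realType) (h : nat) (ab : 'rV[R]_h * 'rV[R]_h)
    : set 'rV[R]_h :=
  [set x | forall j, ab.1 0 j <= x 0 j <= ab.2 0 j].
Definition boxvol (R : realType) (h : nat) (ab : 'rV[R]_h * 'rV[R]_h) : R :=
  \prod_j Num.max (ab.2 0 j - ab.1 0 j) 0.
Definition leb_outer (R : realType) (h : nat) (A : set 'rV[R]_h) : \bar R :=
  ereal_inf [set s | exists (I : set nat) (B : nat -> 'rV[R]_h * 'rV[R]_h),
     A `<=` \bigcup_(i in I) box (B i) /\
     s = (\esum_(i in I) (boxvol (B i))%:E)%E].

Definition orthoframe (R : realType) (h k : nat) (V : set 'rV[R]_k)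
    (M : 'M[R]_(h, k)) : Prop :=
  M *m M^T = 1%:M /\ [set x *m M | x in [set: 'rV[R]_h]] = V.

(* vol_h(S) for S inside an h-dimensional subspace V of R^k: Lebesgue      *)
(* measure of the pullback of S under a (chosen) linear isometry R^h -> V.  *)
Definition vol (R : realType) (h k : nat) (V : set 'rV[R]_k)
    (S : set 'rV[R]_k) : \bar R :=
  leb_outer [set x : 'rV[R]_h | S (x *m xget 0 (@orthoframe R h k V))].

Definition mdim (R : realType) (k : nat) (X : metricType R)
    (T : 'rV[int]_k -> X -> X) (r : R) (h : nat) (V : set 'rV[R]_k)
    : \bar R :=
  lim (limn_einf (fun N : nat =>
          (Widim (dT T (Br r V `&` @icube k N)) eps
           * ((fine (@vol R h k V (V `&` @rcube R k N)))^-1)%:E)%E)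
       @[eps --> (0:R)^'+]).

Definition orth (R : realType) (k : nat) (v : 'rV[R]_k) : set 'rV[R]_k :=
  [set w | \sum_i w 0 i * v 0 i = 0].

(* Main.v *)
(** Let [c] be an expansivity constant. By a compactness argument on continua,
    a continuum that stays [c]-small on a cube of fixed radius [L] is already
    [c / 4]-small. Hence a continuum which is [c / 4]-small on the shell of
    width [L] of a big cube is [c / 4]-small on the whole cube, and arbitrarily
    small on a slightly smaller cube. Let [G] record the distances of the
    iterates [T^n x], [n] in the shell, to a fixed finite net: it takes values
    in a cube of dimension at most [C N^(k-1)], and the quasicomponents of its
    fibers are [eps]-small on the cube of radius [N]. Pulling back fine covers
    of the target and splitting the preimages along quasicomponents yields
    covers of [X] of order [C N^(k-1) + 1] by [eps]-small sets, which bounds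
    the [eps]-width dimension for the whole cube, hence for the part of it near
    any hyperplane. The volume of the hyperplane section is at least of order
    [N^(k-1)]. *)

Require Import Defs.
From HB Require Import structures.
From mathcomp Require Import all_boot all_order all_algebra.
From mathcomp Require Import all_classical all_reals all_analysis.
From mathcomp Require Import measurable_realfun.
From mathcomp Require Import zify ring lra.
Set Implicit Arguments. Unset Strict Implicit. Unset Printing Implicit Defensive.
Import Order.TTheory GRing.Theory Num.Theory.
Import numFieldNormedType.Exports.
Local Open Scope classical_set_scope.
Local Open Scope ring_scope.

(** * Grid covers of cubes *)

(* A point of the cube, rescaled by [n], is described coordinatewise by a pair
   [(far, t)]: either it lies in [(t, t+1)] away from the integers, or it is
   close to [t]. The threshold separating the two regimes depends only on the
   number of far coordinates, so cells with equal such number are disjoint;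
   since it decreases with that number, the cells cover. *)
Definition grid_cell {R : realType} {I : finType} (n : nat)
    (g : {ffun I -> bool * 'I_n.+1}) : set (I -> R) :=
  let th := (#|[pred i | (g i).1]| + 3)%:R^-1 in
  [set y | forall i, if (g i).1
     then (g i).2%:R + th < y i * n%:R /\ y i * n%:R < (g i).2%:R + 1 - th
     else (g i).2%:R - th < y i * n%:R /\ y i * n%:R < (g i).2%:R + th].

(** Bounds the order of a cover: [A] will be the set of indices whose members contain a given point,
    told apart by a label with [D + 1] values. *)
Lemma card_pred_le {J : finType} (D : nat) (A : {pred J}) (f : J -> 'I_D.+1) :
  {in A &, injective f} -> (#|A| <= D.+1)%N.
Proof.
by move=> fI; rewrite -(card_in_imset fI) (leq_trans (max_card _))// card_ord.
Qed.

Lemma invn3_bounds {R : realType} (d : nat) :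
  0 < (d + 3)%:R^-1 :> R /\ (d + 3)%:R^-1 <= 3%:R^-1 :> R.
Proof.
split; first by rewrite invr_gt0 ltr0n addn3.
by rewrite lef_pV2 ?posrE ?ltr0n ?addn3// ler_nat; lia.
Qed.

Lemma grid_cell_inj {R : realType} {I : finType} (n : nat)
    (g h : {ffun I -> bool * 'I_n.+1}) (y : I -> R) :
  #|[pred i | (g i).1]| = #|[pred i | (h i).1]| ->
  grid_cell g y -> grid_cell h y -> g = h.
Proof.
rewrite /grid_cell => -> /= gy hy; apply/ffunP => i.
move: (gy i) (hy i); set th := _^-1.
have [] := @invn3_bounds R #|[pred i | (h i).1]|; rewrite -/th.
move: (y i * _) th => z th th0 th3.
have key (s t : 'I_n.+1) : s%:R < t%:R + (1 : R) -> t%:R < s%:R + (1 : R) -> s = t.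
  by rewrite !natr1 !ltr_nat !ltnS => st ts; apply/val_inj/eqP; rewrite eqn_leq st.
case: (g i) (h i) => [[] s] [[] t] /= [a1 a2] [b1 b2].
- by congr pair; apply: key; lra.
- have [ts|st] := leqP t s.
    exfalso; have : t%:R <= s%:R :> R by rewrite ler_nat. by lra.
  exfalso; have : s%:R + 1 <= t%:R :> R by rewrite natr1 ler_nat. by lra.
- have [ts|st] := leqP s t.
    exfalso; have : s%:R <= t%:R :> R by rewrite ler_nat. by lra.
  exfalso; have : t%:R + 1 <= s%:R :> R by rewrite natr1 ler_nat. by lra.
- by congr pair; apply: key; lra.
Qed.

(** The number of far coordinates must agree with the threshold it determines. Take the least [j]
    such that at most [j] coordinates are at distance at least [th j] from the integers: minimality
    and the decrease of [th] give exactly [j] far coordinates. Coordinates equal to 0 or 1 are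
    integral after rescaling, which forces [j <= D]. *)
Lemma grid_cell_cover {R : realType} {I : finType} (n D : nat) (y : I -> R) :
  (forall i, 0 <= y i <= 1) ->
  (#|[pred i | (y i != 0%R) && (y i != 1%R)]| <= D)%N ->
  exists2 g : {ffun I -> bool * 'I_n.+1},
    (#|[pred i | (g i).1]| <= D)%N & grid_cell g y.
Proof.
move=> y01 yD.
pose z i := y i * n%:R; pose t i := Num.truncn (z i).
pose a i := Num.min (z i - (t i)%:R) ((t i)%:R + 1 - z i).
pose th (j : nat) : R := (j + 3)%:R^-1.
have z0 i : 0 <= z i by rewrite mulr_ge0//; case/andP: (y01 i).
have zn i : z i <= n%:R by rewrite ler_piMl//; case/andP: (y01 i).
have tz i : (t i)%:R <= z i < (t i)%:R + 1 by rewrite natr1 truncn_itv.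
have tn i : (t i <= n)%N.
  by rewrite -(@ler_nat R) (le_trans _ (zn i))//; case/andP: (tz i).
have ex : exists j, (#|[pred i | (th j <= a i)%R]| <= j)%N.
  exists D; apply: leq_trans yD; apply/subset_leq_card/fintype.subsetP => i.
  rewrite !inE => ai; apply/andP; split; apply/eqP => yi; move: ai; apply/negP;
    rewrite -ltNge /a /t /z yi ?mul0r ?mul1r ?truncn0 ?natrK subrr gt_min;
    by have [-> _] := @invn3_bounds R D.
case: (ex_minnP ex) => j jle jmin.
have jD : (j <= D)%N.
  apply: jmin; apply: leq_trans yD; apply/subset_leq_card/fintype.subsetP => i.
  rewrite !inE => ai; apply/andP; split; apply/eqP => yi; move: ai; apply/negP;
    rewrite -ltNge /a /t /z yi ?mul0r ?mul1r ?truncn0 ?natrK subrr gt_min;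
    by have [-> _] := @invn3_bounds R D.
have jge : (j <= #|[pred i | (th j < a i)%R]|)%N.
  case: j jle jmin {jD} => [//|j] _ jmin; rewrite ltnNge; apply/negP => h.
  suff : (j.+1 <= j)%N by rewrite ltnn.
  apply: jmin; apply: leq_trans h.
  apply/subset_leq_card/fintype.subsetP => i; rewrite !inE; apply: lt_le_trans.
  by rewrite ltf_pV2 ?posrE ?ltr0n ?addn3// ltr_nat.
have sub : [pred i | (th j < a i)%R] \subset [pred i | (th j <= a i)%R].
  by apply/fintype.subsetP => i; rewrite !inE => /ltW.
have cardj : #|[pred i | (th j < a i)%R]| = j.
  by apply/eqP; rewrite eqn_leq jge (leq_trans _ jle)// subset_leq_card.
(* The strict and the weak count agree, so no coordinate sits on the threshold, where the open cells
   would miss it. *)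
have far i : (th j <= a i) -> th j < a i.
  have /subset_cardP : #|[pred i | (th j < a i)%R]| = #|[pred i | (th j <= a i)%R]|.
    by apply/eqP; rewrite eqn_leq subset_leq_card// cardj jle.
  by move=> /(_ sub)/(_ i); rewrite !inE => ->.
exists [ffun i => if th j < a i then (true, inord (t i)) else
  if z i <= (t i)%:R + 2^-1 then (false, inord (t i)) else (false, inord (t i).+1)].
  rewrite (_ : #|_| = j)//; apply: etrans cardj; apply: eq_card => i; rewrite !inE ffunE.
  by case: (th j < a i) => //; case: ifP.
rewrite /grid_cell /= (_ : #|_| = j); last first.
  apply: etrans cardj; apply: eq_card => i; rewrite !inE ffunE.
  by case: (th j < a i) => //; case: ifP.
move=> i; rewrite ffunE -/(z i) -/(th j); have /andP[tz1 tz2] := tz i.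
have [] := @invn3_bounds R j; rewrite -/(th j) => th0 th3.
have [|h] := boolP (th j < a i).
  by rewrite /a lt_min /= inordK ?ltnS// => /andP[*]; split; lra.
have {h} : a i < th j by rewrite ltNge; apply/negP => /far; exact/negP.
rewrite /a gt_min => /orP h; have [zt|] := leP (z i) ((t i)%:R + 2^-1) => /=.
  by rewrite inordK ?ltnS//; split; case: h; lra.
move=> zt; rewrite inordK -?natr1; first by split; case: h; lra.
by rewrite ltnS -(@ltr_nat R); apply: lt_le_trans (zn i); lra.
Qed.

Lemma grid_cell_diam {R : realType} {I : finType} (n : nat)
    (g : {ffun I -> bool * 'I_n.+1}) (y y' : I -> R) :
  (0 < n)%N -> grid_cell g y -> grid_cell g y' ->
  forall i, `|y i - y' i| < n%:R^-1.
Proof.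
move=> n0 gy gy' i; have := gy i; have := gy' i.
have [] := @invn3_bounds R #|[pred i | (g i).1]|; set th := _^-1 => th0 th3.
have nR : 0 < n%:R :> R by rewrite ltr0n.
suff h : `|y i * n%:R - y' i * n%:R| < 1 -> `|y i - y' i| < n%:R^-1.
  by case: (g i) => [[] s] /= [? ?] [? ?]; apply: h; rewrite ltr_norml; lra.
by rewrite -mulrBl normrM (ger0_norm (ltW nR)) -ltr_pdivlMr// div1r.
Qed.

Lemma open_finite_forall {T : topologicalType} {I : finType} (P : I -> set T) :
  (forall i, open (P i)) -> open [set x | forall i, P i x].
Proof.
move=> oP; rewrite (_ : mkset _ = ~` \bigcup_(i in [set: I]) ~` P i).
  apply: closed_openC; apply: closed_bigcup => [|i _]; [exact: finite_finset|exact: open_closedC].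
rewrite setC_bigcup; apply/seteqP; split => x /= h.
  by move=> i _; rewrite setCK; exact: h.
by move=> i; have := h i Logic.I; rewrite setCK.
Qed.

Lemma grid_cell_open {R : realType} {I : finType} {T : topologicalType} (n : nat)
    (g : {ffun I -> bool * 'I_n.+1}) (y : T -> I -> R) :
  (forall i, continuous (fun x => y x i)) -> open [set x | grid_cell g (y x)].
Proof.
move=> yc; apply: open_finite_forall => i.
have yn : continuous (fun x => y x i * n%:R).
  by move=> x; apply: cvgMl; exact: yc.
have oI (a b : R) : open [set x | a < y x i * n%:R /\ y x i * n%:R < b].
  apply: openI.
    by apply: (@open_comp _ _ _ [set z | a < z]) => [x _|]; [exact: yn|exact: open_gt].
  by apply: (@open_comp _ _ _ [set z | z < b]) => [x _|]; [exact: yn|exact: open_lt].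
by case: (g i).1; exact: oI.
Qed.

(** * Metric spaces and width dimension *)

Lemma compact_finite_points {T : topologicalType} (A : set T) (V : T -> set T) :
  compact A -> (forall x, A x -> nbhs x (V x)) ->
  exists s : seq T, (forall x, x \in s -> A x) /\
    forall y, A y -> exists2 x, x \in s & V x y.
Proof.
move=> cA nV; apply: contrapT => noS.
pose F := filter_from [set s : seq T | forall x, x \in s -> A x]
  (fun s => [set y | A y /\ forall x, x \in s -> ~ V x y]).
have FF : ProperFilter F.
  apply: filter_from_proper; last first.
    move=> s sA; apply: contrapT => s0; apply: noS; exists s; split => // y Ay.
    apply: contrapT => hy; apply: s0; exists y; split => // x xs Vxy.
    by apply: hy; exists x.
  apply: filter_from_filter; first by exists [::].
  move=> s t sA tA; exists (s ++ t).
    by move=> x; rewrite mem_cat => /orP[/sA|/tA].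
  by move=> y [Ay h]; split; split => // x xs; apply: (h x); rewrite mem_cat xs ?orbT.
have [|p [Ap]] := cA F FF; first by exists [::] => // y [].
have Fp : F [set y | A y /\ forall x, x \in [:: p] -> ~ V x y].
  by exists [:: p] => // x; rewrite inE => /eqP ->.
by move=> /(_ _ _ Fp (nV p Ap))[y [[_ /(_ p (mem_head _ _))]]].
Qed.

Lemma lebesgue_number {R : realType} {T : metricType R} {I : Type} (U : I -> set T) :
  compact [set: T] -> (forall i, open (U i)) -> [set: T] `<=` \bigcup_i U i ->
  exists2 l : R, 0 < l & forall x, exists i, forall y, mdist x y < l -> U i y.
Proof.
move=> cT oU covU.
have h x : exists e : R, 0 < e /\ exists i, forall y, mdist x y < 2 * e -> U i y.
  have [i _ Ux] := covU x Logic.I.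
  have := oU i; rewrite openE => /(_ _ Ux)/nbhs_ballP[e /= e0 eU].
  exists (e / 2); split; first by rewrite divr_gt0.
  exists i => y xy; apply: eU; rewrite ballEmdist /=.
  by move: xy; rewrite mulrC divfK// pnatr_eq0.
have [e he] := choice h.
have [] := @compact_finite_points T setT (fun x => ball x (e x)) cT.
  by move=> x _; apply: nbhsx_ballx; have [] := he x.
move=> s [_ cov].
exists (\big[Num.min/1]_(x <- s) e x).
  by elim/big_ind : _ => // [a b a0 b0|x _]; [rewrite lt_min a0|have [] := he x].
move=> x; have [z zs] := cov x Logic.I; rewrite ballEmdist /= => zx.
have [_ [i hi]] := he z; exists i => y xy; apply: hi.
have : \big[Num.min/1]_(x <- s) e x <= e z by apply: ge_bigmin_seq.
have := metric_triangle z x y; lra.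
Qed.

(** The cap at 1 keeps the infimum meaningful for empty [A], which occurs when a member of a cover
    is the whole space. *)
Definition setdist {R : realType} {T : metricType R} (A : set T) (x : T) : R :=
  inf ([set 1] `|` [set mdist x z | z in A]).

Lemma setdist_lbound {R : realType} {T : metricType R} (A : set T) (x : T) (e : R) :
  e <= 1 -> (forall z, A z -> e <= mdist x z) -> e <= setdist A x.
Proof.
move=> e1 eA; apply: lb_le_inf; first by exists 1; left.
by move=> _ [->//|[z Az <-]]; exact: eA.
Qed.

Lemma setdist_has_lbound {R : realType} {T : metricType R} (A : set T) (x : T) :
  has_lbound ([set (1 : R)] `|` [set mdist x z | z in A]).
Proof. by exists 0 => _ [->//|[z Az <-]]; exact: mdist_ge0. Qed.

Lemma setdist_ge0 {R : realType} {T : metricType R} (A : set T) (x : T) :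
  0 <= setdist A x.
Proof. by apply: setdist_lbound => // z _; exact: mdist_ge0. Qed.

Lemma setdist_le1 {R : realType} {T : metricType R} (A : set T) (x : T) :
  setdist A x <= 1.
Proof. by apply: ge_inf; [exact: setdist_has_lbound|left]. Qed.

Lemma setdist_le {R : realType} {T : metricType R} (A : set T) (x z : T) :
  A z -> setdist A x <= mdist x z.
Proof. by move=> Az; apply: ge_inf; [exact: setdist_has_lbound|right; exists z]. Qed.

Lemma setdist_mem {R : realType} {T : metricType R} (A : set T) (x : T) :
  A x -> setdist A x = 0.
Proof.
move=> Ax; apply/eqP; rewrite eq_le setdist_ge0 andbT.
by rewrite -(mdistxx x) setdist_le.
Qed.

Lemma setdist_gt0 {R : realType} {T : metricType R} (A : set T) (x : T) :
  closed A -> ~ A x -> 0 < setdist A x.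
Proof.
move=> cA nAx; have := closed_openC cA; rewrite openE => /(_ _ nAx).
move=> /nbhs_ballP[e /= e0]; rewrite ballEmdist => eA.
apply: (@lt_le_trans _ _ (Num.min e 1)); first by rewrite lt_min e0 ltr01.
apply: setdist_lbound => [|z Az]; rewrite ge_min ?lexx ?orbT//.
by rewrite leNgt; apply/orP; left; apply/negP => /eA.
Qed.

Lemma setdist_continuous {R : realType} {T : metricType R} (A : set T) :
  continuous (setdist A : T -> R).
Proof.
have lip x y : setdist A x <= mdist x y + setdist A y.
  rewrite -lerBlDl; apply: setdist_lbound.
    by rewrite lerBlDl (le_trans (setdist_le1 _ _))// lerDr mdist_ge0.
  move=> z Az; rewrite lerBlDl.
  exact: le_trans (setdist_le _ Az) (metric_triangle _ _ _).
move=> x; apply/cvgrPdist_lt => e e0.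
apply/nbhs_ballP; exists e => //= y; rewrite ballEmdist /= => xy.
by apply: le_lt_trans xy; rewrite ler_norml; have := lip x y; have := lip y x;
  rewrite (metric_sym y x); lra.
Qed.

(* The image of [f] with the sup distance; as a type of its own it inherits
   compactness from the domain of [f]. *)
Definition image_type {R : realType} {T : Type} {J : finType} (f : T -> J -> R)
  : Type := {y : {ffun J -> R} | `[< exists x, y = [ffun j => f x j] >]}.

HB.instance Definition _ (R : realType) (T : Type) (J : finType) (f : T -> J -> R) :=
  Choice.on (image_type f).

Definition image_dist {R : realType} {T : Type} {J : finType} {f : T -> J -> R}
  (y z : image_type f) : R := \big[Num.max/0]_j `|sval y j - sval z j|.

Lemma image_distxx {R : realType} {T : Type} {J : finType} {f : T -> J -> R}
  (y : image_type f) : image_dist y y = 0.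
Proof.
rewrite /image_dist; under eq_bigr do rewrite subrr normr0.
by elim/big_rec: _ => // j x _ ->; rewrite maxxx.
Qed.

Lemma image_dist_ge {R : realType} {T : Type} {J : finType} {f : T -> J -> R}
  (y z : image_type f) j : `|sval y j - sval z j| <= image_dist y z.
Proof. exact: le_bigmax. Qed.

Lemma image_dist_eq0 {R : realType} {T : Type} {J : finType} {f : T -> J -> R}
  (y z : image_type f) : image_dist y z = 0 -> y = z.
Proof.
move=> yz; apply/val_inj/ffunP => j; apply/eqP; rewrite -subr_eq0 -normr_le0.
by rewrite -yz; exact: image_dist_ge.
Qed.

Lemma image_dist_sym {R : realType} {T : Type} {J : finType} {f : T -> J -> R}
  (y z : image_type f) : image_dist y z = image_dist z y.
Proof. by apply: eq_bigr => j _; rewrite distrC. Qed.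

Lemma image_dist_triangle {R : realType} {T : Type} {J : finType} {f : T -> J -> R}
  (y x z : image_type f) : image_dist x z <= image_dist x y + image_dist y z.
Proof.
apply: bigmax_le => [|j _]; first by rewrite addr_ge0// /image_dist bigmax_ge_id.
by rewrite (le_trans (ler_distD (sval y j) _ _))// lerD// image_dist_ge.
Qed.

HB.instance Definition _ (R : realType) (T : Type) (J : finType) (f : T -> J -> R) :=
  isMetric.Build R (image_type f) image_distxx image_dist_eq0 image_dist_sym
    image_dist_triangle.

Lemma image_type_bounds {R : realType} {T : Type} {J : finType} (f : T -> J -> R) (D : nat)
    (y : image_type f) :
  (forall x j, 0 <= f x j <= 1) ->
  (forall x, #|[pred j | (f x j != 0%R) && (f x j != 1%R)]| <= D)%N ->
  (forall j, 0 <= sval y j <= 1) /\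
  (#|[pred j | (sval y j != 0%R) && (sval y j != 1%R)]| <= D)%N.
Proof.
move=> f01 fD; case: y => y /= /asboolP[x ->]; split => [j|]; first by rewrite ffunE.
by apply: leq_trans (fD x); apply/subset_leq_card/fintype.subsetP => j; rewrite !inE ffunE.
Qed.

Lemma lipschitz1_continuous {R : realType} {K : metricType R} (h : K -> R) :
  (forall y z, `|h y - h z| <= mdist y z) -> continuous h.
Proof.
move=> lip y; apply/cvgrPdist_lt => e e0; apply/nbhs_ballP; exists e => //= z.
by rewrite ballEmdist /=; apply: le_lt_trans.
Qed.

Lemma min1_continuous {R : realType} {T : topologicalType} (h : T -> R) :
  continuous h -> continuous (fun x => Num.min 1 (h x)).
Proof.
move=> ch x; apply/cvgrPdist_lt => e e0; move: (ch x) => /cvgrPdist_lt/(_ e e0).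
apply: filterS => y; apply: le_lt_trans; rewrite ler_norml.
have := ler_norm (h x - h y); have := ler_norm (h y - h x); rewrite (distrC (h y)).
by rewrite !minEle; case: ifP; case: ifP; lra.
Qed.

Lemma image_coord_continuous {R : realType} {T : Type} {J : finType} (f : T -> J -> R) j :
  continuous (fun y : image_type f => sval y j : R).
Proof. by apply: lipschitz1_continuous => y z; exact: image_dist_ge. Qed.

(** Fine cells with at most [D] far coordinates cover the image, and cells through one point are
    told apart by their number of far coordinates, one of [0, ..., D]. *)
Lemma image_type_covdim {R : realType} {T : Type} {J : finType} (f : T -> J -> R) (D : nat) :
  compact [set: image_type f] ->
  (forall x j, 0 <= f x j <= 1) ->
  (forall x, #|[pred j | (f x j != 0%R) && (f x j != 1%R)]| <= D)%N ->
  covdim_le (image_type f) D.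
Proof.
move=> cK f01 fD I U oU covU.
have [l l0 lU] := lebesgue_number cK oU covU.
pose n := (Num.truncn l^-1).+1.
have nl : n%:R^-1 < l.
  by rewrite invf_plt ?posrE ?ltr0n// truncnS_gt.
pose W (g : {ffun J -> bool * 'I_n.+1}) : set (image_type f) :=
  [set y : image_type f | (#|[pred j | (g j).1]| <= D)%N /\ grid_cell g (fun j => sval y j)].
have oW g : open (W g).
  have [gD|gD] := boolP (#|[pred j | (g j).1]| <= D)%N; last first.
    rewrite (_ : W g = set0); first exact: open0.
    by apply/seteqP; split => // y [hg]; rewrite hg in gD.
  rewrite (_ : W g = [set y : image_type f | grid_cell g (fun j => sval y j)]).
    by apply: grid_cell_open => j; exact: image_coord_continuous.
  by apply/seteqP; split => [y []|y].
pose G := {g | `[< W g !=set0 >]}.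
exists G, (fun g => W (sval g)); split.
- by move=> g; exact: oW.
- move=> y _; have [y01 yD] := image_type_bounds y f01 fD.
  have [g gD gy] := grid_cell_cover n y01 yD.
  have Wgy : W g y by [].
  have Wg : `[< W g !=set0 >] by apply/asboolP; exists y.
  by exists (exist _ g Wg).
- move=> [g /= /asboolP[y [gD gy]]]; have [i hi] := lU y; exists i => z [_ gz].
  apply: hi; apply: le_lt_trans nl; apply: bigmax_le => [|j _].
    by rewrite invr_ge0 ler0n.
  by apply/ltW/(grid_cell_diam _ gy gz).
- move=> y; apply: (@card_pred_le _ _ _
    (fun g : G => inord #|[pred j | (sval g j).1]|)) => g h.
  rewrite !inE => /asboolP[gD gy] /asboolP[hD hy] /(congr1 (@nat_of_ord _)).
  rewrite !inordK// => gh; apply/val_inj; exact: grid_cell_inj gh gy hy.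
Qed.

(** Points with the same image under a nerve map share a coordinate equal to 1, hence a set [E j],
    so the map is an [eps]-embedding. *)
Lemma Widim_le_cover {R : realType} {T : metricType R} {J : finType} (dist : T -> T -> R)
    (eps : R) (D : nat) (E : J -> set T) :
  compact [set: T] -> (forall j, open (E j)) -> [set: T] `<=` \bigcup_j E j ->
  (forall x, #|[pred j | `[< E j x >]]| <= D.+1)%N ->
  (forall j x x', E j x -> E j x' -> dist x x' < eps) ->
  (Widim dist eps <= D%:R%:E)%E.
Proof.
move=> cT oE covE ordE smallE.
have [l l0 lE] := lebesgue_number cT oE covE.
(* [setdist] never exceeds 1, so the radius is capped as well for some coordinate to reach 1. *)
pose s := Num.min l 1.
have s0 : 0 < s by rewrite lt_min l0 ltr01.
pose phi x j := setdist (~` E j) x.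
(* A nerve map without normalisation of the sum: [f x] always has a coordinate
   equal to 1, so at most [D] coordinates lie strictly between 0 and 1. *)
pose f x j : R := Num.min 1 (phi x j / s).
have fin x j : 0 < f x j -> E j x.
  move=> h; apply: contrapT => nE; move: h.
  by rewrite /f /phi setdist_mem// mul0r lt_min ltxx andbF.
have f0 x j : 0 <= f x j.
  by rewrite le_min ler01 divr_ge0// ?setdist_ge0// ltW.
have f1 x j : f x j <= 1 by rewrite ge_min lexx.
have fone x : exists j, f x j = 1.
  have [j hj] := lE x; exists j; apply/eqP; rewrite eq_le f1 le_min lexx /=.
  rewrite ler_pdivlMr// mul1r; apply: setdist_lbound.
    by rewrite ge_min lexx orbT.
  by move=> z zE; rewrite ge_min; apply/orP; left; rewrite leNgt; apply/negP => /hj.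
have fD x : (#|[pred j | (f x j != 0%R) && (f x j != 1%R)]| <= D)%N.
  have [j0 fj0] := fone x; rewrite -ltnS; apply: leq_trans (ordE x).
  apply/proper_card/properP; split.
    apply/fintype.subsetP => j; rewrite !inE => /andP[fj _].
    by apply: fin; rewrite lt_neqAle eq_sym fj f0.
  exists j0; rewrite !inE ?fj0 ?eqxx ?andbF//.
  by apply: fin; rewrite fj0.
have fc j : continuous (fun x => f x j).
  apply: min1_continuous => x; apply: cvgMl; exact: setdist_continuous.
have im x : `[< exists x0, [ffun j => f x j] = [ffun j => f x0 j] >] by apply/asboolP; exists x.
pose F x : image_type f := exist _ [ffun j => f x j] (im x).
have cF : continuous F.
  move=> x; apply/metricType_numDomainType.cvgrPdist_lt => e e0.
  have : \forall y \near x, forall j, `|f x j - f y j| < (e / 2 : R).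
    by apply: filter_forall => j; move: (fc j x) => /cvgrPdist_lt; apply; rewrite divr_gt0.
  apply: filterS => y h; apply: (@le_lt_trans _ _ (e / 2)); last lra.
  by apply: bigmax_le => [|j _]; [lra|rewrite /= !ffunE ltW].
have cK : compact [set: image_type f].
  rewrite (_ : setT = F @` setT).
    by apply: continuous_compact => //; exact: continuous_subspaceT.
  apply/seteqP; split => // -[y yP] _; have /asboolP[x yx] := yP; exists x => //.
  exact/val_inj.
apply: ereal_inf_lbound; exists D => //; exists (image_type f), F; split => //.
- move=> x x' /(congr1 sval) /= /ffunP xx'; have [j fj] := fone x.
  by apply: (smallE j); apply: fin; have := xx' j; rewrite !ffunE fj// => <-.
- by apply: image_type_covdim => // x j; rewrite f0 f1.
Qed.

(** * Quasicomponents of fibers *)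

Lemma closed_setD {T : topologicalType} (C O : set T) :
  closed C -> open O -> closed (C `\` O).
Proof. by move=> cC oO; apply: closedI => //; exact: open_closedC. Qed.

Definition clopen_in {T : topologicalType} (F C : set T) : Prop :=
  [/\ C `<=` F, closed C & closed (F `\` C)].

Lemma clopen_inI {T : topologicalType} (F C D : set T) :
  clopen_in F C -> clopen_in F D -> clopen_in F (C `&` D).
Proof.
move=> [CF cC cFC] [DF cD cFD]; split; [by move=> x [/CF]|exact: closedI|].
by rewrite setDIr; exact: closedU.
Qed.

Lemma closed_separation {R : realType} {T : metricType R} (P Q : set T) :
  closed P -> closed Q -> P `&` Q = set0 ->
  exists A1 A2 : set T, [/\ open A1, open A2, P `<=` A1, Q `<=` A2 & A1 `&` A2 = set0].
Proof.
move=> cP cQ PQ.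
have oS (A B : set T) : open [set y | setdist A y < setdist B y].
  rewrite (_ : mkset _ = [set y | setdist A y - setdist B y < 0]); last first.
    by apply/seteqP; split => y /=; rewrite subr_lt0.
  apply: (@open_comp _ _ (fun y => setdist A y - setdist B y) [set z | z < 0]).
    by move=> y _; apply: cvgB; exact: setdist_continuous.
  exact: open_lt.
exists [set y | setdist P y < setdist Q y], [set y | setdist Q y < setdist P y].
split => //.
- move=> y Py /=; rewrite setdist_mem// setdist_gt0// => Qy.
  by have : (P `&` Q) y by []; rewrite PQ.
- move=> y Qy /=; rewrite setdist_mem// setdist_gt0// => Py.
  by have : (P `&` Q) y by []; rewrite PQ.
- by apply/seteqP; split => // y [/= a b]; have := lt_trans a b; rewrite ltxx.
Qed.

(** Relatively clopen sets containing [x] are stable under intersection. If none lay in [O], their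
    closed remainders outside [O] would generate a proper filter, whose cluster point lies in the
    quasicomponent of [x] but not in [O]. *)
Lemma quasicomponent_sub {T : topologicalType} (F O : set T) (x : T) :
  compact [set: T] -> closed F -> F x -> open O ->
  (forall y, (forall C, clopen_in F C -> C x -> C y) -> O y) ->
  exists C, [/\ clopen_in F C, C x & C `<=` O].
Proof.
move=> cT cF Fx oO QO; apply: contrapT => noC.
have FF : clopen_in F F by split => //; rewrite setDv; exact: closed0.
pose B := [set C | clopen_in F C /\ C x].
pose FB := filter_from B (fun C => C `\` O).
have FP : ProperFilter FB.
  apply: filter_from_proper; last first.
    move=> C [FC Cx]; apply: contrapT => C0; apply: noC; exists C; split => //.
    by move=> y Cy; apply: contrapT => Oy; apply: C0; exists y.
  apply: filter_from_filter; first by exists F.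
  move=> C D [FC Cx] [FD Dx]; exists (C `&` D); first by split => //; exact: clopen_inI.
  by move=> y [[Cy Dy] Oy].
have [|p [_ clp]] := cT FB FP; first by exists F.
have inC C : B C -> (C `\` O) p.
  move=> BC; have : closed (C `\` O).
    by apply: closed_setD => //; case: BC => -[].
  rewrite closure_id => ->; move=> V Vp.
  have FBC : FB (C `\` O) by exists C.
  by have [z [? ?]] := clp _ V FBC Vp; exists z.
have [_] := inC F (conj FF Fx); apply; apply: QO => C FC Cx.
by have [] := inC C (conj FC Cx).
Qed.

Lemma closed_connected {T : topologicalType} (Q : set T) : closed Q ->
  (forall P P', closed P -> closed P' -> P `&` P' = set0 -> Q = P `|` P' ->
     P = set0 \/ P' = set0) -> connected Q.
Proof.
move=> cQ split2 B [b Bb] [U oU BU] [V cV BV].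
have cB : closed B by rewrite BV; exact: closedI.
have cQB : closed (Q `\` B).
  rewrite (_ : Q `\` B = Q `\` U); first exact: closed_setD.
  by rewrite BU; apply/seteqP; split => y [Qy h]; split => //; [move=> Uy|case=> _ Uy]; apply: h.
have BQ : B `<=` Q by rewrite BV => y [].
have QE : Q = B `|` (Q `\` B).
  apply/seteqP; split => y; last by case=> [/BQ|[]].
  by move=> Qy; have [By|By] := pselect (B y); [left|right].
have BD : B `&` (Q `\` B) = set0 by apply/seteqP; split => // y [By []].
case: (split2 _ _ cB cQB BD QE) => [B0|D0]; first by rewrite B0 in Bb.
by rewrite QE D0 setU0.
Qed.

(** In a compact metric space the quasicomponent [Q] of [x] in a closed set is connected, so the
    hypothesis on connected sets puts [Q] inside [O]. *)
Lemma clopen_of_connected {R : realType} {T : metricType R} (F O : set T) (x : T) :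
  compact [set: T] -> closed F -> F x -> open O ->
  (forall A, connected A -> A `<=` F -> A x -> A `<=` O) ->
  exists C, [/\ clopen_in F C, C x & C `<=` O].
Proof.
move=> cT cF Fx oO hO; apply: quasicomponent_sub => //.
pose Q := [set y | forall C, clopen_in F C -> C x -> C y].
have FF : clopen_in F F by split => //; rewrite setDv; exact: closed0.
have QF : Q `<=` F by move=> y; exact.
have cQ : closed Q.
  rewrite (_ : Q = \bigcap_(C in [set C | clopen_in F C /\ C x]) C).
    by apply: closed_bigI => C [[]].
  apply/seteqP; split => y h; first by move=> C []; exact: h.
  by move=> C FC Cx; apply: h.
suff : connected Q by move=> /hO; apply => //; exact: QF.
(* If [Q] splits, a relatively clopen [C] around [x] fits into the union of disjoint open sets
   around the pieces. Its part in [A1] is again clopen in [F], so [Q] misses [P']. *)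
have part (P P' : set T) : closed P -> closed P' -> P `&` P' = set0 ->
    Q = P `|` P' -> P x -> P' = set0.
  move=> cP cP' PP' QPP' Px.
  have [A1 [A2 [oA1 oA2 PA1 PA2 A12]]] := closed_separation cP cP' PP'.
  have QA y : Q y -> (A1 `|` A2) y by rewrite QPP' => -[/PA1|/PA2]; [left|right].
  have [C [FC Cx CO]] := quasicomponent_sub cT cF Fx (openU oA1 oA2) QA.
  have FCO : clopen_in F (C `&` A1).
    have [CF cC cFC] := FC; split; first by move=> y [/CF].
      rewrite (_ : C `&` A1 = C `\` A2); first exact: closed_setD.
      apply/seteqP; split => y [Cy Oy]; split => //.
        by move=> A2y; have : (A1 `&` A2) y by []; rewrite A12.
      by have [] := CO _ Cy.
    rewrite setDIr; apply: closedU => //.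
    rewrite (_ : F `\` A1 = F `&` ~` A1)//; apply: closedI => //.
    exact: open_closedC.
  apply/seteqP; split => // y P'y.
  have Qy : Q y by rewrite QPP'; right.
  have [_ A1y] := Qy _ FCO (conj Cx (PA1 _ Px)).
  suff : (A1 `&` A2) y by rewrite A12.
  by split => //; exact: PA2.
apply: closed_connected => // P P' cP cP' PP' QE.
have : Q x by [].
rewrite {1}QE => -[Px|Px]; [right|left]; first exact: part QE Px.
by apply: (part P' P) => //; rewrite 1?setIC 1?setUC.
Qed.

(** [A1] and [A2] separate [C] from the rest of the fiber. Off their union, [G] stays away from
    [G x] by compactness, so a whole tube around the fiber splits in two. *)
Lemma fiber_nbhs {R : realType} {T : metricType R} {I : finType} (G : T -> I -> R)
    (x : T) (C U : set T) :
  compact [set: T] -> (forall i, continuous (fun y => G y i)) -> open U ->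
  clopen_in [set y | forall i, G y i = G x i] C -> C `<=` U ->
  exists (A1 A2 : set T) (s : R), [/\ open A1, open A2, A1 `&` A2 = set0,
    C `<=` A1 /\ A1 `<=` U & 0 < s /\
    forall y, (forall i, `|G y i - G x i| < s) -> (A1 `|` A2) y].
Proof.
move=> cT cG oU [CF cC cFC] CU.
have CFC : C `&` ([set y | forall i, G y i = G x i] `\` C) = set0.
  by apply/seteqP; split => // y [Cy []].
have [A1 [A2 [oA1 oA2 CA1 FA2 A12]]] := closed_separation cC cFC CFC.
pose Z := ~` ((A1 `&` U) `|` A2).
have oAU : open ((A1 `&` U) `|` A2) by apply: openU => //; exact: openI.
have cZ : compact Z.
  by apply: (subclosed_compact _ cT) => //; exact: open_closedC.
have h y : exists d : R, 0 < d /\ (Z y -> \forall z \near y, exists i, d <= `|G z i - G x i|).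
  have [Zy|nZ] := pselect (Z y); last by exists 1.
  have [i Gi] : exists i, G y i <> G x i.
    apply/existsNP => Fy; apply: Zy.
    have [Cy|nC] := pselect (C y); last by right; apply: FA2.
    by left; split; [exact: CA1|exact: CU].
  have g0 : 0 < `|G y i - G x i| by rewrite normr_gt0 subr_eq0; apply/eqP.
  exists (`|G y i - G x i| / 2); split; first by rewrite divr_gt0.
  move=> _; move: (cG i y) => /cvgrPdist_lt/(_ (`|G y i - G x i| / 2)) H.
  have {}H := H (divr_gt0 g0 (ltr0Sn _ 1)); apply: filterS H => z zy; exists i.
  have := ler_distD (G z i) (G y i) (G x i); lra.
have [d hd] := choice h.
have [t [tZ cov]] := compact_finite_points cZ (fun y => (hd y).2).
exists (A1 `&` U), A2, (\big[Num.min/1]_(y <- t) d y); split => //.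
- exact: openI.
- by apply/seteqP; split => // y [[a _] b]; have : (A1 `&` A2) y by []; rewrite A12.
- by split => y; [move=> Cy; split; [exact: CA1|exact: CU]|case].
- split.
    by elim/big_ind : _ => // [a b a0 b0|y _]; [rewrite lt_min a0|have [] := hd y].
  move=> y Gy; apply: contrapT => /cov[z zt [i]]; apply/negP; rewrite -ltNge.
  by apply: lt_le_trans (Gy i) _; exact: ge_bigmin_seq.
Qed.

(** Preimages of grid cells are cut into pieces along the splittings of finitely many tubes. Pieces
    of one cell are disjoint, so the order remains that of the grid cover. *)
Lemma fiber_cover {R : realType} {T : metricType R} {I : finType} (G : T -> I -> R)
    (U : T -> set T) :
  compact [set: T] -> (forall i, continuous (fun y => G y i)) ->
  (forall y i, 0 <= G y i <= 1) -> (forall x, open (U x)) ->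
  (forall x, exists C,
    [/\ clopen_in [set y | forall i, G y i = G x i] C, C x & C `<=` U x]) ->
  exists (J : finType) (E : J -> set T), [/\ forall j, open (E j),
    [set: T] `<=` \bigcup_j E j,
    forall x, (#|[pred j | `[< E j x >]]| <= #|I|.+1)%N &
    forall j, exists x, E j `<=` U x].
Proof.
move=> cT cG G01 oU hC.
(* Halving the radius leaves room for a cell that meets the smaller tube to lie in the larger one,
   which [A1] and [A2] cover. *)
have h x : exists q : (set T * set T * R)%type, [/\ open q.1.1, open q.1.2, q.1.1 `&` q.1.2 = set0,
    q.1.1 x /\ q.1.1 `<=` U x & 0 < q.2 /\
    forall y, (forall i, `|G y i - G x i| < 2 * q.2) -> (q.1.1 `|` q.1.2) y].
  have [C [FC Cx CU]] := hC x.
  have [A1 [A2 [s [oA1 oA2 A12 [CA AU] [s0 hs]]]]] := fiber_nbhs cT cG (oU x) FC CU.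
  exists (A1, A2, s / 2); split => //=.
    by split => //; exact: CA.
  by split => [|y]; [rewrite divr_gt0|rewrite mulrC divfK ?pnatr_eq0//; exact: hs].
have {h} [q hq] := choice h.
pose A1 x := (q x).1.1; pose A2 x := (q x).1.2; pose s x := (q x).2.
have oV x : open [set y | A1 x y /\ forall i, `|G y i - G x i| < s x].
  apply: openI; first by have [] := hq x.
  apply: open_finite_forall => i.
  apply: (@open_comp _ _ (fun y => `|G y i - G x i|) [set z | z < s x]).
    by move=> y _; apply: cvg_norm; apply: cvgB; [exact: cG|exact: cvg_cst].
  exact: open_lt.
have nV x : [set: T] x -> nbhs x [set y | A1 x y /\ forall i, `|G y i - G x i| < s x].
  move=> _; apply: open_nbhs_nbhs; split; first exact: oV.
  have [_ _ _ [A1x _] [sx _]] := hq x; split => // i.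
  by rewrite subrr normr0.
have [t [_ cov]] := compact_finite_points cT nV.
pose p (a : 'I_(size t)) := tnth (in_tuple t) a.
pose l := \big[Num.min/1]_(a < size t) s (p a).
have l0 : 0 < l.
  rewrite /l; elim/big_ind : _ => // [a b a0 b0|a _]; first by rewrite lt_min a0.
  by have [_ _ _ _ []] := hq (p a).
pose n := (Num.truncn l^-1).+1.
have nl : n%:R^-1 < l by rewrite invf_plt ?posrE ?ltr0n// truncnS_gt.
have n0 : (0 < n)%N by [].
pose W (g : {ffun I -> bool * 'I_n.+1}) : set T := [set y | grid_cell g (G y)].
pose inV g a := forall y, W g y -> forall i, `|G y i - G (p a) i| < 2 * s (p a).
(* Points of a cell go to the first index [a] whose tube contains the cell and whose [A1] contains
   the point; at earlier such tubes they lie in [A2]. *)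
pose E (j : {ffun I -> bool * 'I_n.+1} * 'I_(size t)) : set T :=
  [set y | [/\ W j.1 y, inV j.1 j.2, A1 (p j.2) y &
     forall b : 'I_(size t), (b < j.2)%N -> inV j.1 b -> A2 (p b) y]].
(* [E (g, a)] is open since, on the preimage of the cell [g], not being in
   [A1 (p b)] amounts to being in the open set [A2 (p b)]. *)
exists ({ffun I -> bool * 'I_n.+1} * 'I_(size t))%type, E; split.
- move=> [g a].
  have oP (P : Prop) (A : set T) : open A -> open [set y | P -> A y].
    move=> oA; have [hP|hP] := pselect P.
      by rewrite (_ : mkset _ = A)//; apply/seteqP; split => y /=; [apply|move=> ? _].
    by rewrite (_ : mkset _ = setT); [exact: openT|apply/seteqP; split => // y _ /= /hP].
  have [ha|ha] := pselect (inV g a); last first.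
    by rewrite (_ : E _ = set0); [exact: open0|apply/seteqP; split => // y []].
  rewrite (_ : E _ = W g `&` (A1 (p a) `&` [set y | forall b : 'I_(size t),
     (b < a)%N -> inV g b -> A2 (p b) y])); last first.
    by apply/seteqP; split => [y [? ? ? ?]|y [? [? ?]]]; do ?split.
  apply: openI; first exact: grid_cell_open.
  apply: openI; first by have [] := hq (p a).
  apply: open_finite_forall => b; apply: (oP); apply: (oP).
  by have [] := hq (p b).
- move=> y _.
  have [g gD gy] := @grid_cell_cover R I n #|I| (G y) (G01 y) (max_card _).
  have [x xt [A1x sx]] := cov y Logic.I.
  have ex : exists m : nat, `[< exists a : 'I_(size t), [/\ m = a, inV g a & A1 (p a) y] >].
    have xs : (index x t < size t)%N by rewrite index_mem.
    have px : p (Ordinal xs) = x by rewrite /p (tnth_nth x) /= nth_index.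
    exists (index x t); apply/asboolP; exists (Ordinal xs); rewrite px; split => //.
    move=> z gz i; rewrite px.
    have := ler_distD (G y i) (G z i) (G x i).
    have := grid_cell_diam n0 gz gy i.
    have : l <= s x by rewrite -px; exact: bigmin_le.
    have := sx i; move: nl; rewrite -/(s x); lra.
  case: (ex_minnP ex) => m /asboolP[a [-> ga A1a]] amin.
  exists (g, a) => //; split => // b ba gb.
  have [_ _ _ _ [_ /(_ y (gb y gy))[A1b|//]]] := hq (p b).
  have : (a <= b)%N by apply: amin; apply/asboolP; exists b.
  by rewrite leqNgt ba.
- move=> y; apply: (@card_pred_le _ _ _ 
    (fun j : {ffun I -> bool * 'I_n.+1} * 'I_(size t) => inord #|[pred i | (j.1 i).1]|)).
  move=> [g a] [h b]; rewrite !inE => -[/= gy ga A1a A2a] [/= hy hb A1b A2b].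
  move=> /(congr1 (@nat_of_ord _)); rewrite !inordK ?ltnS ?max_card// => gh.
  have {}gh := grid_cell_inj gh gy hy; rewrite -{h}gh in hy hb A2b *.
  (* For [a < b] in the same cell, a common point would lie in both [A1 (p a)] and [A2 (p a)]. *)
  congr pair; apply/val_inj/eqP; rewrite eqn_leq leqNgt [X in _ && X]leqNgt.
  apply/andP; split; apply/negP => ab.
    have [_ _ A12 _ _] := hq (p b).
    have : (A1 (p b) `&` A2 (p b)) y by split => //; exact: A2a.
    by rewrite /A1 /A2 A12.
  have [_ _ A12 _ _] := hq (p a).
  have : (A1 (p a) `&` A2 (p a)) y by split => //; exact: A2b.
  by rewrite /A1 /A2 A12.
- move=> [g a]; exists (p a) => y [_ _ A1y _].
  by have [_ _ _ [_ AU] _] := hq (p a); exact: AU.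
Qed.

(** * Uniform continuum-wise expansivity *)

Lemma ultra_limit {I : Type} {T : topologicalType} (U : set_system I) (x : I -> T) (K : set T) :
  UltraFilter U -> compact [set: T] -> closed K -> U (x @^-1` K) ->
  exists2 p, K p & forall V, nbhs p V -> U (x @^-1` V).
Proof.
move=> UU cT cK UK; have PU : ProperFilter U by exact: ultra_proper.
have [//|p [_ clp]] := cT (x @ U) _; first exact: filterT.
have lim V : nbhs p V -> U (x @^-1` V).
  move=> Vp; have [//|nV] := in_ultra_setVsetC (x @^-1` V) UU.
  by have [z []] := clp (~` V) V nV Vp.
exists p => //; rewrite (closure_id K).1// => V Vp.
by have [z [Kz Vz]] := filter_ex (filterI UK (lim V Vp)); exists (x z).
Qed.

(** A set limit along an ultrafilter, for which lower and upper limits coincide; it replaces a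
    convergent subsequence in the hyperspace of closed sets. *)
Definition ultra_set_limit {I : Type} {T : topologicalType} (U : set_system I)
    (A : I -> set T) : set T :=
  [set z | forall V, nbhs z V -> U [set i | (A i `&` V) !=set0]].

Lemma ultra_set_limit_closed {I : Type} {T : topologicalType} (U : set_system I)
    (A : I -> set T) : closed (ultra_set_limit U A).
Proof.
move=> z clz V Vz; have [w [Aw Vw]] := clz _ (nbhs_interior Vz).
exact: Aw.
Qed.

(** If the limit split, almost all [A i] would meet two disjoint open sets around the pieces without
    being covered by them, and a limit of uncovered points would lie in neither piece. *)
Lemma ultra_set_limit_connected {R : realType} {I : Type} {T : metricType R}
    (U : set_system I) (A : I -> set T) :
  UltraFilter U -> compact [set: T] -> (forall i, connected (A i)) ->
  connected (ultra_set_limit U A).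
Proof.
move=> UU cT cA; have PU : ProperFilter U by exact: ultra_proper.
apply: closed_connected; first exact: ultra_set_limit_closed.
move=> P P' cP cP' PP' AE.
have [->|/set0P[z Pz]] := eqVneq P set0; first by left.
have [->|/set0P[w Pw]] := eqVneq P' set0; first by right.
exfalso; have [A1 [A2 [oA1 oA2 PA1 PA2 A12]]] := closed_separation cP cP' PP'.
have Az : ultra_set_limit U A z by rewrite AE; left.
have Aw : ultra_set_limit U A w by rewrite AE; right.
have U1 := Az _ (open_nbhs_nbhs (conj oA1 (PA1 _ Pz))).
have U2 := Aw _ (open_nbhs_nbhs (conj oA2 (PA2 _ Pw))).
have hv i : exists v, (A i `&` A1) !=set0 -> (A i `&` A2) !=set0 ->
    (A i `\` (A1 `|` A2)) v.
  have [[v Av]|nv] := pselect ((A i `\` (A1 `|` A2)) !=set0); first by exists v.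
  exists z => A1i [u [Au A2u]].
  have E : A i `&` A1 = A i.
    apply: cA => //; first by exists A1.
    exists (~` A2); first exact: open_closedC.
    apply/seteqP; split => y [Ay h]; split => //.
      by move=> A2y; have : (A1 `&` A2) y by []; rewrite A12.
    apply: contrapT => A1y; apply: nv; exists y; split => // -[|]//.
  have [_ A1u] : (A i `&` A1) u by rewrite E.
  by have : (A1 `&` A2) u by []; rewrite A12.
have [v {}hv] := choice hv.
have Uv : U (v @^-1` (~` (A1 `|` A2))).
  by apply: filterS (filterI U1 U2) => i [h1 h2]; have [] := hv i h1 h2.
have [|p nAp limp] := ultra_limit UU cT _ Uv.
  by apply: open_closedC; exact: openU.
have : ultra_set_limit U A p.
  move=> V Vp; apply: filterS (filterI (filterI U1 U2) (limp V Vp)).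
  by move=> i [[h1 h2] Vv]; exists (v i); have [] := hv i h1 h2.
by rewrite AE => -[/PA1|/PA2] h; apply: nAp; [left|right].
Qed.

Lemma icubeS (k N M : nat) : (N <= M)%N -> @icube k N `<=` @icube k M.
Proof. by move=> NM u uN i; rewrite (le_trans (uN i))// lez_nat. Qed.

Lemma in_icube (k : nat) (u : 'rV[int]_k) : exists N, icube N u.
Proof.
exists (\max_i absz (u 0%R i))%N => i; rewrite -abszE lez_nat.
exact: (@leq_bigmax _ (fun i => absz (u 0 i))).
Qed.

Lemma cw_expansive_separation {R : realType} {k : nat} {X : metricType R}
    (T : 'rV[int]_k -> X -> X) :
  cw_expansive T -> exists2 c : R, 0 < c & forall A : set X, connected A -> closed A ->
    (forall n x y, A x -> A y -> mdist (T n x) (T n y) <= c) ->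
    forall x y, A x -> A y -> x = y.
Proof.
move=> [c [c0 hc]]; exists c => // A cA clA small x y Ax Ay; apply: contrapT => xy.
have [n] := hc A (ex_intro _ x Ax) cA clA (ex_intro _ x (ex_intro _ y (And3 Ax Ay xy))).
apply/negP; rewrite -leNgt; apply: ge_ereal_sup => _ [[_ _] [[z Az <-] [w Aw <-]] <-].
by rewrite lee_fin small.
Qed.

(** Counterexamples for growing [L] converge along an ultrafilter to a continuum that is [c]-small
    under every iterate, hence degenerate, while it contains limits of points more than [e]
    apart. *)
Lemma uniform_cw_expansive {R : realType} {k : nat} {X : metricType R}
    (T : 'rV[int]_k -> X -> X) (c : R) :
  compact [set: X] -> (forall n, continuous (T n)) ->
  (forall A : set X, connected A -> closed A ->
    (forall n x y, A x -> A y -> mdist (T n x) (T n y) <= c) ->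
    forall x y, A x -> A y -> x = y) ->
  forall e : R, 0 < e -> exists L : nat, forall A : set X, connected A ->
    (forall n x y, icube L n -> A x -> A y -> mdist (T n x) (T n y) <= c) ->
    forall x y, A x -> A y -> mdist x y <= e.
Proof.
move=> cX cT hc e e0; apply: contrapT => noL.
have h L : exists q : (set X * X * X)%type, [/\ connected q.1.1,
    forall n x y, icube L n -> q.1.1 x -> q.1.1 y -> mdist (T n x) (T n y) <= c,
    q.1.1 q.1.2, q.1.1 q.2 & e < mdist q.1.2 q.2].
  apply: contrapT => nq; apply: noL; exists L => A cA sA x y Ax Ay.
  by rewrite leNgt; apply/negP => xy; apply: nq; exists (A, x, y).
have {h noL} [q hq] := choice h.
pose A L := (q L).1.1.
have [U [UU FU]] := ultraFilterLemma eventually_filter.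
have PU : ProperFilter U by exact: ultra_proper.
have lim (x : nat -> X) : (forall L, A L (x L)) ->
    exists2 p, ultra_set_limit U A p & forall V, nbhs p V -> U (x @^-1` V).
  move=> Ax; have [p _ limp] := @ultra_limit _ _ U x setT UU cX closedT filterT.
  exists p => // V /limp; apply: filterS => L; by exists (x L).
have [p Ap limp] := lim (fun L => (q L).1.2) (fun L => let: And5 _ _ h _ _ := hq L in h).
have [p' Ap' limp'] := lim (fun L => (q L).2) (fun L => let: And5 _ _ _ h _ := hq L in h).
have pp' : p = p'.
  apply: (hc (ultra_set_limit U A)) => //.
  - by apply: ultra_set_limit_connected => // L; have [] := hq L.
  - exact: ultra_set_limit_closed.
  move=> n x y Ax Ay; apply/ler_addgt0Pr => d d0.
  have nb z : nbhs z [set w | mdist (T n z) (T n w) < d / 2].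
    by move: (cT n z) => /metricType_numDomainType.cvgrPdist_lt; apply; rewrite divr_gt0.
  have [N hN] := in_icube n.
  have UN : U [set L | (N <= L)%N] by apply: FU; exists N.
  have [L [[x' [AxL xx']] [y' [AyL yy']] NL]] :
      exists L, [/\ (A L `&` [set w | mdist (T n x) (T n w) < d / 2]) !=set0,
         (A L `&` [set w | mdist (T n y) (T n w) < d / 2]) !=set0 & (N <= L)%N].
    have [L [[? ?] ?]] := filter_ex (filterI (filterI (Ax _ (nb x)) (Ay _ (nb y))) UN).
    by exists L.
  have [_ sL _ _ _] := hq L; have := sL n x' y' (icubeS NL hN) AxL AyL.
  have := metric_triangle (T n x) (T n x') (T n y).
  have := metric_triangle (T n x') (T n y') (T n y).
  rewrite (metric_sym (T n y')); move: xx' yy' => /=; lra.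
have e2 : 0 < e / 2 by rewrite divr_gt0.
rewrite -pp' in limp'.
have [L []] := filter_ex (filterI (limp _ (nbhsx_ballx p _ e2)) (limp' _ (nbhsx_ballx p _ e2))).
rewrite !ballEmdist /= => h1 h2; have [_ _ _ _] := hq L.
have := metric_triangle (q L).1.2 p (q L).2; rewrite (metric_sym (q L).1.2 p); lra.
Qed.

(** * Volume of boxes *)

(* Integrating the covering inequality in one coordinate at a time replaces an
   indicator by a side length. *)
Lemma weighted_boxes_volume {R : realType} (h : nat) (a C : R) (w : nat -> R)
    (lo hi : nat -> 'I_h -> R) :
  0 <= a -> 0 <= C -> (forall i, 0 <= w i) ->
  (forall x : 'I_h -> R, (forall j, - a <= x j <= a) ->
    (C%:E <= \sum_(0 <= i <oo) (w i * \prod_j \1_(`[lo i j, hi i j]) (x j))%:E)%E) ->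
  ((C * (2 * a) ^+ h)%:E <=
    \sum_(0 <= i <oo) (w i * \prod_j Num.max (hi i j - lo i j) 0)%:E)%E.
Proof.
move=> a0; elim: h C w lo hi => [|h IH] C w lo hi C0 w0 cov.
  rewrite expr0 mulr1; have := cov (fun=> 0).
  rewrite (eq_eseriesr (g := fun i => (w i * \prod_(j < 0) Num.max (hi i j - lo i j) 0)%:E)).
    by apply => -[].
  by move=> i _; rewrite !big_ord0.
rewrite exprS mulrA.
(* The first side length is absorbed into the weights, which makes the induction close. *)
have := IH (C * (2 * a)) (fun i => w i * Num.max (hi i ord0 - lo i ord0) 0)
  (fun i j => lo i (lift ord0 j)) (fun i j => hi i (lift ord0 j)).
rewrite (eq_eseriesr (g := fun i => (w i * \prod_j Num.max (hi i j - lo i j) 0)%:E)); last first.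
  by move=> i _; rewrite big_ord_recl mulrA.
apply; [by rewrite !mulr_ge0|by move=> i; rewrite mulr_ge0// le_max lexx orbT|].
move=> x xa.
pose p i : R := \prod_j \1_(`[lo i (lift ord0 j), hi i (lift ord0 j)]) (x j).
have p0 i : 0 <= p i by apply: prodr_ge0 => j _; rewrite indicE.
pose D : set R := [set` `[- a, a]].
have mD : measurable D by exact: measurable_itv.
pose f i (t : R) : \bar R := (w i * p i * \1_(`[lo i ord0, hi i ord0]) t)%:E.
have mf i : measurable_fun D (f i).
  apply/measurable_EFinP; apply: measurable_funM; first exact: measurable_cst.
  exact: measurable_indic.
have f0 i t : D t -> (0 <= f i t)%E.
  by move=> _; rewrite lee_fin mulr_ge0 ?indicE ?mulr_ge0.
have muD : (@lebesgue_measure R D = (2 * a)%:E)%E.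
  rewrite lebesgue_measure_itv /= lte_fin; case: ifPn => [_|].
    by rewrite -EFinD; congr EFin; lra.
  by rewrite -leNgt => ?; congr EFin; lra.
apply: (@le_trans _ _ (\int[@lebesgue_measure R]_(t in D) (\sum_(0 <= i <oo) f i t))%E).
  rewrite EFinM -muD -integral_cst//; apply: ge0_le_integral => //.
  - by apply: (@ge0_emeasurable_sum _ _ _ D f xpredT) => [i t Dt _|i _]; [exact: f0|exact: mf].
  - move=> t; rewrite /D /= in_itv /= => ta.
    have := cov (fun j => if unlift ord0 j is Some j' then x j' else t).
    rewrite /cst => /(_ _)/le_trans; apply.
      by move=> j; case: unliftP => [j' _|_]; [exact: xa|].
    rewrite le_eqVlt; apply/orP; left; apply/eqP/eq_eseriesr => i _.
    rewrite big_ord_recl /f unlift_none; congr EFin; rewrite -!mulrA; congr (_ * _).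
    by rewrite mulrC; congr (_ * _); apply: eq_bigr => j _; rewrite liftK.
rewrite integral_nneseries//; apply: lee_nneseries => i _.
  by move=> _; apply: integral_ge0 => t; exact: f0.
pose J : set R := [set` `[lo i ord0, hi i ord0]].
have mJ : measurable J by exact: measurable_itv.
rewrite -[leLHS]/(\int[@lebesgue_measure R]_(t in D) ((w i * p i)%:E * (\1_J t)%:E))%E.
rewrite [leLHS](_ : _ =
    ((w i * p i)%:E * \int[@lebesgue_measure R]_(t in D) (\1_J t)%:E)%E); last first.
  apply: ge0_integralZl_EFin => //; last by rewrite mulr_ge0.
  by apply/measurable_EFinP; exact: measurable_indic.
rewrite integral_indic//.
rewrite [X in (_ <= X%:E)%E](_ : _ = w i * p i * Num.max (hi i ord0 - lo i ord0) 0); last first.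
  by rewrite -!mulrA; congr (_ * _); rewrite mulrC.
rewrite [leRHS]EFinM; apply: lee_wpmul2l; first by rewrite lee_fin mulr_ge0.
apply: (@le_trans _ _ (@lebesgue_measure R J)).
  by apply: le_measure; rewrite ?inE//; exact: measurableI.
rewrite /J lebesgue_measure_itv /=; case: ifPn => _; last by rewrite lee_fin le_max lexx orbT.
by rewrite -EFinD lee_fin le_max lexx.
Qed.

Lemma leb_outer_cube {R : realType} (h : nat) (a : R) (S : set 'rV[R]_h) :
  0 <= a -> [set x : 'rV[R]_h | forall j, - a <= x 0 j <= a] `<=` S ->
  (((2 * a) ^+ h)%:E <= leb_outer S)%E.
Proof.
move=> a0 cS; apply: le_ereal_inf_tmp => _ [I [B [SB ->]]].
rewrite (_ : I = [set i | i \in I]); last by apply/seteqP; split => i /=; rewrite inE.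
rewrite -(@nneseries_esum _ (fun i => (boxvol (B i))%:E) (fun i => i \in I)); last first.
  by move=> i _; rewrite lee_fin prodr_ge0// => j _; rewrite le_max lexx orbT.
rewrite eseries_mkcond.
rewrite (eq_eseriesr (g := fun i => (((i \in I)%:R : R) *
    \prod_j Num.max ((B i).2 0 j - (B i).1 0 j) 0)%:E)); last first.
  by move=> i _; case: (i \in I); rewrite ?mul1r ?mul0r.
rewrite -[X in (X%:E <= _)%E]mul1r; apply: weighted_boxes_volume => // x xa.
have [|i Ii Bi] := SB (\row_j x j).
  by apply: cS => j; rewrite mxE; exact: xa.
apply: le_trans (nneseries_lim_ge i.+1 _); last first.
  by move=> j _ _; rewrite lee_fin mulr_ge0// prodr_ge0// => ? _; rewrite indicE.
rewrite big_nat_recr //= [X in (_ <= _ + X%:E)%E](_ : _ = 1).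
  by rewrite leeDr// sume_ge0// => j _; rewrite lee_fin mulr_ge0// prodr_ge0// => ? _;
    rewrite indicE.
rewrite mem_set// mul1r; apply: big1 => j _; rewrite indicE mem_set//= in_itv /=.
by have := Bi j; rewrite mxE.
Qed.

(** * Width dimension of cubes *)

Lemma mdist_continuous {R : realType} {S : topologicalType} {X : metricType R}
    (z : X) (f : S -> X) : continuous f -> continuous (fun y => mdist z (f y) : R).
Proof.
move=> cf y; apply: (@continuous_comp _ _ _ f (mdist z)); first exact: cf.
apply: lipschitz1_continuous => u v; rewrite ler_norml.
have := metric_triangle z u v; have := metric_triangle z v u.
by rewrite (metric_sym v u); lra.
Qed.

Lemma closed_forall_le {R : realType} {S : topologicalType} {I : Type}
    (P : I -> Prop) (f : I -> S -> R) (b : R) :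
  (forall i, continuous (f i)) -> closed [set y | forall i, P i -> f i y <= b].
Proof.
move=> cf; rewrite (_ : mkset _ = \bigcap_(i in [set i | P i]) ~` [set y | b < f i y]).
  apply: closed_bigI => i _; apply: open_closedC.
  apply: (@open_comp _ _ (f i) [set z | b < z]); last exact: open_gt.
  by move=> y _; exact: cf.
by apply/seteqP; split => y /= h i Pi; have := h i Pi; rewrite /= leNgt => /negP.
Qed.

(** Enumerating the cube by a finite type lets conditions at all its points define open sets. *)
Definition icube_point (k N : nat) (f : {ffun 'I_k -> 'I_(2 * N).+1}) : 'rV[int]_k :=
  \row_i ((f i)%:Z - N%:Z).

Lemma icube_coord (N : nat) (a : int) : `|a| <= N%:Z ->
  {t : 'I_(2 * N).+1 | a = t%:Z - N%:Z}.
Proof.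
move=> aN; have t : (`|(a + N%:Z)%R| < (2 * N).+1)%N by lia.
by exists (Ordinal t) => /=; lia.
Qed.

Lemma icube_pointP (k N : nat) (u : 'rV[int]_k) : icube N u ->
  exists f, u = @icube_point k N f.
Proof.
move=> uN; exists [ffun i => sval (icube_coord (uN i))].
apply/rowP => i; rewrite mxE ffunE; exact: svalP (icube_coord (uN i)).
Qed.

(* The points of the cube of radius [P] with some coordinate of absolute value
   above [P - L], enumerated (with repetitions) by that coordinate, its sign,
   its depth below [P], and the remaining coordinates. *)
Definition shell_point (k L P : nat)
    (s : 'I_k.+1 * bool * 'I_L * {ffun 'I_k -> 'I_(2 * P).+1}) : 'rV[int]_k.+1 :=
  let: (i0, b, l, f) := s in
  \row_i if unlift i0 i is Some j then (f j)%:Z - P%:Z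
         else if b then P%:Z - l%:Z else l%:Z - P%:Z.

Lemma shell_pointP (k L P : nat) (u : 'rV[int]_k.+1) : icube P u ->
  ~ (forall i, `|u 0 i| + L%:Z <= P%:Z) -> exists s, u = @shell_point k L P s.
Proof.
move=> uP /existsNP[i0 /negP]; rewrite -ltNge => i0P.
have l : (P - `|u 0%R i0| < L)%N by have := uP i0; lia.
exists (i0, 0 <= u 0 i0, Ordinal l, [ffun j => sval (icube_coord (uP (lift i0 j)))]).
apply/rowP => i; rewrite mxE; case: unliftP => [j ->|->] /=.
  by rewrite ffunE; exact: svalP (icube_coord (uP _)).
by have := uP i0; case: ifP; lia.
Qed.

Lemma icubeD (k N M : nat) (u v : 'rV[int]_k) :
  icube N u -> icube M v -> icube (N + M) (u + v).
Proof.
by move=> uN vM i; rewrite mxE PoszD (le_trans (ler_normD _ _))// lerD.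
Qed.

(* A continuum inside a fiber of [G] that stays [c]-small on the whole cube is
   [c / 4]-small inside the cube by uniform expansivity and on the shell
   because [G] separates points there; so quasicomponents cannot grow. *)
Lemma Widim_shell_bound {R : realType} {k : nat} {X : metricType R}
    (T : 'rV[int]_k.+1 -> X -> X) :
  compact [set: X] -> is_Zk_action T -> cw_expansive T ->
  exists C : nat, forall eps : R, 0 < eps -> exists M : nat, forall N Omega,
    Omega `<=` @icube k.+1 N ->
    (Widim (dT T Omega) eps <= (C * (2 * (N + M)).+1 ^ k)%:R%:E)%E.
Proof.
move=> cX [T0 TD cT] /cw_expansive_separation[c c0 hc].
have unif := uniform_cw_expansive cX cT hc.
have [L hL] : exists L : nat, forall A : set X, connected A ->
    (forall n x y, icube L n -> A x -> A y -> mdist (T n x) (T n y) <= c) ->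
    forall x y, A x -> A y -> mdist x y <= c / 4 by apply: unif; rewrite divr_gt0.
(* The cap at 1 matches the truncation in [G], and [c / 8] makes two points with the same truncated
   distances to the net [c / 4]-close. *)
pose eta : R := Num.min 1 (c / 8).
have eta0 : 0 < eta by rewrite lt_min ltr01 divr_gt0.
have [z [_ netz]] := compact_finite_points cX
  (fun (x : X) (_ : [set: X] x) => nbhsx_ballx x eta eta0).
(* The factors count the special coordinate of a shell point, its sign, its depth, and the net
   points; the other coordinates account for the power of the side. *)
exists (k.+1 * 2 * L * size z)%N => eps eps0.
(* Continua that are [c]-small on the cube of radius [N + M] will be [eps / 8]-small on that of
   radius [N], with [M] independent of [N]. *)
have [M hM] : exists L : nat, forall A : set X, connected A ->
    (forall n x y, icube L n -> A x -> A y -> mdist (T n x) (T n y) <= c) ->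
    forall x y, A x -> A y -> mdist x y <= eps / 8 by apply: unif; rewrite divr_gt0.
exists M => N Omega OmegaN; set P := (N + M)%N.
pose I : finType := ('I_k.+1 * bool * 'I_L * {ffun 'I_k -> 'I_(2 * P).+1} * 'I_(size z))%type.
pose G (y : X) (i : I) : R :=
  Num.min 1 (mdist (tnth (in_tuple z) i.2) (T (shell_point i.1) y)).
have cG i : continuous (fun y => G y i).
  by apply: min1_continuous; exact: mdist_continuous.
have G01 y i : 0 <= G y i <= 1 by rewrite /G le_min ler01 mdist_ge0 ge_min lexx.
pose U (x : X) : set X := [set y | forall f : {ffun 'I_k.+1 -> 'I_(2 * P).+1},
  mdist (T (icube_point f) x) (T (icube_point f) y) < c / 2] `&`
  [set y | forall f : {ffun 'I_k.+1 -> 'I_(2 * N).+1},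
  mdist (T (icube_point f) x) (T (icube_point f) y) < eps / 4].
have oU x : open (U x).
  have o n (b : R) : open [set y | mdist (T n x) (T n y) < b].
    apply: (@open_comp _ _ (fun y => mdist (T n x) (T n y)) [set z | z < b]).
      by move=> y _; exact: mdist_continuous.
    exact: open_lt.
  by apply: openI; apply: open_finite_forall => f; exact: o.
have fib x : exists C,
    [/\ clopen_in [set y | forall i, G y i = G x i] C, C x & C `<=` U x].
  set Fib := [set y | _].
  (* Connected sets through [x] are first confined to [B], where they are [c]-small on the cube;
     this improves the distance to [x] from [c / 2] to [c / 4], hence into [U x]. *)
  pose B := [set y | forall n, icube P n -> mdist (T n x) (T n y) <= c / 2].
  have cFib : closed Fib.
    rewrite (_ : Fib = [set y | forall i : I, True -> `|G y i - G x i| <= 0]).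
      apply: closed_forall_le => i y; apply: cvg_norm; apply: cvgB; first exact: cG.
      exact: cvg_cst.
    apply/seteqP; split => y h i; first by move=> _; rewrite h subrr normr0.
    by apply/eqP; rewrite -subr_eq0 -normr_le0; exact: h.
  have cB : closed B.
    by apply: closed_forall_le => n; exact: mdist_continuous.
  have FB : closed (Fib `&` B) by exact: closedI.
  have FBx : (Fib `&` B) x by split => // n _; rewrite mdistxx divr_ge0// ltW.
  have [|C [[CF cC cFC] Cx CU]] := clopen_of_connected cX FB FBx (oU x).
    move=> A cA AF Ax.
    have imc n : connected (T n @` A).
      by apply: connected_continuous_connected => //; exact: continuous_subspaceT.
    have smallP n y y' : icube P n -> A y -> A y' -> mdist (T n y) (T n y') <= c.
      move=> nP /AF[_ /(_ n nP) xy] /AF[_ /(_ n nP) xy'].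
      have := metric_triangle (T n y) (T n x) (T n y').
      rewrite (metric_sym (T n y) (T n x)); move: xy xy'; lra.
    (* Uniform smallness applies to the image of [A] under [T n] as soon as the translated cube
       stays in the big one. *)
    have img Q b n : (forall A : set X, connected A ->
        (forall n x y, icube Q n -> A x -> A y -> mdist (T n x) (T n y) <= c) ->
        forall x y, A x -> A y -> mdist x y <= b) ->
        (forall m, icube Q m -> icube P (m + n)) ->
        forall y y', A y -> A y' -> mdist (T n y) (T n y') <= b.
      move=> hQ QP y y' Ay Ay'; apply: (hQ (T n @` A)) => //.
      move=> m _ _ mQ [u Au <-] [u' Au' <-]; rewrite -!TD; apply: smallP => //.
      exact: QP.
    have quarter n y : icube P n -> A y -> mdist (T n x) (T n y) <= c / 4.
      move=> nP Ay.
      have [inner|/(shell_pointP nP)[s ns]] :=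
          pselect (forall i, `|n 0 i| + L%:Z <= P%:Z).
        apply: img hL _ _ _ Ax Ay => m mL i; rewrite mxE (le_trans (ler_normD _ _))//.
        by rewrite (le_trans _ (inner i))// addrC lerD2l; exact: mL.
      have [Fx _] := AF _ Ax; have [Fy _] := AF _ Ay.
      have [w wz] := netz (T n x) Logic.I; rewrite ballEmdist /= => xw.
      have wi : (index w z < size z)%N by rewrite index_mem.
      have := Fy (s, Ordinal wi); rewrite /G -ns (tnth_nth w) /= nth_index// => Gyx.
      have : Num.min 1 (mdist w (T n y)) < eta by rewrite Gyx gt_min xw orbT.
      rewrite gt_min ltNge {1}/eta ge_min lexx /= => yw.
      have : eta <= c / 8 by rewrite ge_min lexx orbT.
      have := metric_triangle (T n x) w (T n y); rewrite (metric_sym (T n x) w).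
      by move: xw yw; lra.
    move=> y Ay; split => f /=.
      apply: (@le_lt_trans _ _ (c / 4)); last by move: (c) c0 => d d0; lra.
      apply: quarter => // i; rewrite mxE.
      by have := ltn_ord (f i); lia.
    apply: (@le_lt_trans _ _ (eps / 8)); last by lra.
    apply: img hM _ _ _ Ax Ay => m mM; rewrite addrC; apply: icubeD => // i.
    by rewrite mxE; have := ltn_ord (f i); lia.
  (* [C] is clopen in the fiber itself: it lies in the open set [U x], whose points in the fiber all
     belong to [B]. *)
  exists C; split => //; split => //; first by move=> y /CF[].
  rewrite (_ : Fib `\` C = ((Fib `&` B) `\` C) `|` (Fib `\` U x)).
    by apply: closedU => //; exact: closed_setD.
  apply/seteqP; split => y; last first.
    by case=> [[[Fy _] nC]|[Fy nU]]; split => // /CU.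
  move=> [Fy nC]; have [[Uy _]|nU] := pselect (U x y); [left|by right].
  by split => //; split => // n /icube_pointP[f ->]; rewrite ltW.
have [J [E [oE covE ordE smallE]]] := fiber_cover cX cG G01 oU fib.
have cardI : #|I| = (k.+1 * 2 * L * size z * (2 * P).+1 ^ k)%N.
  by rewrite !card_prod !card_ord card_bool card_ffun !card_ord; lia.
rewrite -cardI; apply: (Widim_le_cover cX oE covE ordE) => j y y' Ey Ey'.
have [x Ex] := smallE j.
apply: (@le_lt_trans _ _ (eps / 2)); last by lra.
rewrite /dT; have [->|/set0P Om0] := eqVneq Omega set0.
  by rewrite image_set0 sup0 divr_ge0// ltW.
apply: ge_sup; first by have [n On] := Om0; exists (mdist (T n y) (T n y')), n.
move=> _ [n /OmegaN/icube_pointP[f ->] <-].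
have [_ /(_ f) xy] := Ex _ Ey; have [_ /(_ f) xy'] := Ex _ Ey'.
have := metric_triangle (T (icube_point f) y) (T (icube_point f) x) (T (icube_point f) y').
by rewrite (metric_sym (T (icube_point f) y) (T (icube_point f) x)); move: xy xy'; lra.
Qed.

(** * Hyperplane sections and the final estimate *)

Lemma orthonormal_entry_le1 {R : realType} (h k : nat) (M : 'M[R]_(h, k)) i j :
  M *m M^T = 1%:M -> `|M i j| <= 1.
Proof.
move=> /matrixP/(_ i i); rewrite !mxE eqxx => MM.
rewrite -(@expr_le1 _ 2)// -normrX ger0_norm ?sqr_ge0// -[leRHS]MM.
rewrite (bigD1 j)//= mxE -expr2 lerDl sumr_ge0// => l _.
by rewrite mxE -expr2 sqr_ge0.
Qed.

(** An orthonormal frame has entries at most 1 in absolute value, so it maps the cube of half side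
    [N / k] in dimension [k - 1] into the cube of radius [N]. *)
Lemma vol_orth_ge {R : realType} (k N : nat) (v : 'rV[R]_k) : (0 < k)%N ->
  (((2 * (N%:R / k%:R)) ^+ k.-1)%:E <=
    @vol R k.-1 k (orth v) (orth v `&` @rcube R k N))%E.
Proof.
move=> k0; have k0R : 0 < k%:R :> R by rewrite ltr0n.
have a0 : 0 <= N%:R / k%:R :> R by rewrite divr_ge0.
apply: leb_outer_cube => // x xa /=.
(* If there were no orthonormal frame, [xget] would return the zero matrix. *)
case: xgetP => [M _ [MM MV]|_]; last first.
  split=> [|i]; last by rewrite mulmx0 mxE normr0.
  by rewrite /orth /=; apply: big1 => i _; rewrite mulmx0 mxE mul0r.
split=> [|i]; first by rewrite -MV; exists x.
rewrite mxE; apply: le_trans (ler_norm_sum _ _ _) _.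
apply: (@le_trans _ _ (\sum_(j < k.-1) (N%:R / k%:R : R))).
  apply: ler_sum => j _; rewrite normrM -[leRHS]mulr1 ler_pM//.
    by rewrite ler_norml; exact: xa.
  exact: orthonormal_entry_le1.
rewrite sumr_const card_ord -[leLHS]mulr_natr -mulrA ler_piMr//.
by rewrite mulrC ler_pdivrMr// mul1r ler_nat leq_pred.
Qed.

Lemma limn_einf_le {R : realType} (u : nat -> \bar R) (b : \bar R) (N0 : nat) :
  (forall N, (N0 <= N)%N -> (u N <= b)%E) -> (limn_einf u <= b)%E.
Proof.
move=> ub; rewrite limn_einf_lim; apply: lime_le; first exact: is_cvg_einfs.
apply: nearW => n; apply: ge_ereal_inf; exists (u (maxn n N0)).
  by exists (maxn n N0) => //=; rewrite leq_maxl.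
by apply: ub; rewrite leq_maxr.
Qed.

(** A divergent [lim] takes the default value 0, hence the requirement on the sign of [b]. *)
Lemma lim_at_right_le {R : realType} (f : R -> \bar R) (b : \bar R) :
  (0 <= b)%E -> (forall e, 0 < e -> (f e <= b)%E) ->
  (lim (f e @[e --> 0^'+]) <= b)%E.
Proof.
move=> b0 fb; have [fc|/dvgP ->//] := pselect (cvg (f e @[e --> 0^'+])).
by apply: lime_le => //; near=> e; exact: fb.
Unshelve. all: by end_near. Qed.

Unset Implicit Arguments.

Theorem theorem1p2 (R : realType) (k : nat) (X : metricType R)
    (T : 'rV[int]_k -> X -> X) :
  (0 < k)%N -> compact [set: X] -> is_Zk_action T -> cw_expansive T ->
  exists C : R, 0 <= C /\
    forall r : R, Num.sqrt (k%:R) / 2 < r ->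
    forall v : 'rV[R]_k, v != 0 ->
      (mdim T r k.-1 (orth v) <= C%:E)%E.
Proof.
case: k T => [//|k] T _ cX actT cwT.
have [C0 hC] := Widim_shell_bound cX actT cwT.
(* For [N] at least [M] and 1, [2 * (N + M) + 1 <= 5 * N]; dividing by the side [2 * N / k.+1] of
   the volume bound gives [5 * k.+1 / 2]. *)
pose C : R := C0%:R * (5 * k.+1%:R / 2) ^+ k.
have C_ge0 : 0 <= C by rewrite mulr_ge0// exprn_ge0// !mulr_ge0// invr_ge0.
exists C; split => // r _ v _.
apply: lim_at_right_le; rewrite ?lee_fin// => eps eps0.
have [M hM] := hC eps eps0.
apply: (@limn_einf_le _ _ _ (maxn M 1)) => N; rewrite geq_max => /andP[MN N1].
have := @vol_orth_ge R k.+1 N v isT.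
(* An infinite volume would be turned into 0 by [fine]. *)
case: (vol _ _) => [w| |] /=; rewrite ?leNye ?invr0 ?mule0 ?lee_fin//.
move=> volw.
have N0 : 0 < N%:R :> R by rewrite ltr0n.
have b0 : 0 < (2 * (N%:R / k.+1%:R)) ^+ k :> R.
  by rewrite exprn_gt0// !mulr_gt0// invr_gt0.
have w0 : 0 < w by exact: lt_le_trans volw.
(* The bound for the whole cube serves every hyperplane and every [r]. *)
apply: (@le_trans _ _ ((C0 * (2 * (N + M)).+1 ^ k)%:R%:E * w^-1%:E)%E).
  apply: lee_wpmul2r; first by rewrite lee_fin invr_ge0 ltW.
  by apply: hM => u [].
rewrite -EFinM lee_fin natrM -mulrA /C ler_wpM2l// ler_pdivrMr//.
apply: (@le_trans _ _ ((5 * k.+1%:R / 2) ^+ k * (2 * (N%:R / k.+1%:R)) ^+ k)); last first.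
  by rewrite ler_wpM2l// exprn_ge0// !mulr_ge0// invr_ge0.
rewrite -exprMn (_ : _ * _ = (5 * N)%:R).
  by rewrite natrX lerXn2r ?nnegrE// ler_nat; lia.
rewrite natrM; field; by rewrite nat1r pnatr_eq0.
Qed.
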